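(* Let $Z=z_1e_1+z_2e_2$ and $\mathcal V=\alpha_1+j\alpha_2=\nu_1e_1+\nu_2e_2$ be elements of $\mathbb{BC}$. For each fixed $Z\notin\mathcal O_2$, the bicomplex Bessel function $\mathcal J_{\mathcal V}(Z)$ is a (bicomplex) holomorphic function of $\mathcal V$.
   Context: Bicomplex numbers: $\mathbb{BC}=\{\lambda_1+j\lambda_2:\lambda_1,\lambda_2\in\mathbb C(i)\}$ with commuting units $i,j$, $i^2=j^2=-1$, $k=ij$, $k^2=1$. Put $e_1=\frac{1+k}{2}$, $e_2=\frac{1-k}{2}$; then $e_1+e_2=1$, $e_l^2=e_l$, $e_1e_2=0$. Every $Z=\lambda_1+j\lambda_2$ has the unique idempotent representation $Z=z_1e_1+z_2e_2$ with $z_1=\lambda_1-i\lambda_2$, $z_2=\lambda_1+i\lambda_2\in\mathbb C(i)$. The set of zero divisors is $\mathcal O_2=\{\lambda_1+j\lambda_2:\lambda_1^2+\lambda_2^2=0\}=\{Z: z_1z_2=0\}$. A function $g:X\subset\mathbb{BC}\to\mathbb{BC}$ is differentiable at $W_0$ if $\lim_{W\to W_0,\ W-W_0\notin\mathcal O_2}\frac{g(W)-g(W_0)}{W-W_0}$ exists finitely, and bicomplex holomorphic in $X$ if it is differentiable at every point of $X$. Equivalently, writing $g=g_1+jg_2$ as a function of $W=\alpha_1+j\alpha_2$, $g_1,g_2$ are holomorphic in $(\alpha_1,\alpha_2)$ and $\frac{\partial g_1}{\partial\alpha_1}=\frac{\partial g_2}{\partial\alpha_2}$, $\frac{\partial g_1}{\partial\alpha_2}=-\frac{\partial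 g_2}{\partial\alpha_1}$. Powers and Gamma: $Z^{\mathcal V}=z_1^{\nu_1}e_1+z_2^{\nu_2}e_2$, with complex powers $z^\nu=\exp(\nu\log z)$ for fixed values of $\log z_1,\log z_2$. $\Gamma_b(Z)=\Gamma(z_1)e_1+\Gamma(z_2)e_2$, and $1/\Gamma$ is read as the entire function $1/\Gamma$. Bicomplex Bessel function: for $\mathcal V,Z\in\mathbb{BC}$, $$\mathcal J_{\mathcal V}(Z)=\sum_{s=0}^\infty\frac{(-1)^s}{\Gamma_b(\mathcal V+s+1)s!}\left(\frac Z2\right)^{\mathcal V+2s},$$ equivalently $\mathcal J_{\mathcal V}(Z)=J_{\nu_1}(z_1)e_1+J_{\nu_2}(z_2)e_2$ with $J_\nu$ the classical Bessel function of the first kind. *)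

(* Defs.v *)
From Stdlib Require Export Reals.
From Stdlib Require Import Factorial ClassicalEpsilon.
From Coquelicot Require Export Coquelicot.

(** * Complex functions *)

Open Scope C_scope.

Definition Cexp (z : C) : C :=
  (exp (Re z) * cos (Im z), exp (Re z) * sin (Im z))%R.

(** [log] chooses a value of the logarithm of every nonzero number; no
    continuity is required. *)
Definition is_log (log : C -> C) : Prop :=
  forall z : C, z <> 0 -> Cexp (log z) = z.

Definition Cpower (log : C -> C) (z nu : C) : C := Cexp (nu * log z).

(** These two are meaningful when the limit, resp. the sum, exists. *)
Definition C_lim_seq (u : nat -> C) : C :=
  @iota C_CompleteNormedModule (fun l : C => filterlim u eventually (locally l)).

Definition C_Series (a : nat -> C) : C :=
  @iota C_CompleteNormedModule (fun l : C => is_series a l).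

(** [rising z n] is z (z + 1) ... (z + n), with n + 1 factors. *)
Fixpoint rising (z : C) (n : nat) : C :=
  match n with
  | O => z
  | S m => rising z m * (z + INR n)
  end.

(** Gauss' product: Gamma z = lim n! n^z / (z (z + 1) ... (z + n)), where
    n^z = exp (z ln n) with the real logarithm. *)
Definition CGamma (z : C) : C :=
  C_lim_seq (fun n => INR (fact n) * Cexp (z * ln (INR n)) / rising z n).

Definition Gamma_pole (z : C) : Prop := exists n : nat, z = - INR n.

(** The entire function 1 / Gamma: it vanishes at the poles of Gamma. *)
Definition CrGamma (z : C) : C :=
  if excluded_middle_informative (Gamma_pole z) then 0 else / CGamma z.

(** * Bicomplex numbers *)

(** The pair (l1, l2) stands for l1 + j l2. The topology is the product one. *)
Definition BC : Type := (C * C)%type.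

Definition CtoBC (l : C) : BC := (l, RtoC 0).
Definition RtoBC (r : R) : BC := CtoBC (RtoC r).

Definition BCi : BC := CtoBC Ci.
Definition BCj : BC := (RtoC 0, RtoC 1).

Definition BCplus (Z W : BC) : BC := (fst Z + fst W, snd Z + snd W).
Definition BCopp (Z : BC) : BC := (- fst Z, - snd Z).
Definition BCminus (Z W : BC) : BC := BCplus Z (BCopp W).
Definition BCmult (Z W : BC) : BC :=
  (fst Z * fst W - snd Z * snd W, fst Z * snd W + snd Z * fst W).

(** 1 / (l1 + j l2) = (l1 - j l2) / (l1^2 + l2^2), outside [O2]. *)
Definition BCinv (Z : BC) : BC :=
  (fst Z / (fst Z * fst Z + snd Z * snd Z),
   - snd Z / (fst Z * fst Z + snd Z * snd Z)).
Definition BCdiv (Z W : BC) : BC := BCmult Z (BCinv W).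

Declare Scope BC_scope.
Delimit Scope BC_scope with BC.
Bind Scope BC_scope with BC.
Infix "+" := BCplus : BC_scope.
Notation "- Z" := (BCopp Z) : BC_scope.
Infix "-" := BCminus : BC_scope.
Infix "*" := BCmult : BC_scope.
Notation "/ Z" := (BCinv Z) : BC_scope.
Infix "/" := BCdiv : BC_scope.

Definition O2 (Z : BC) : Prop := fst Z * fst Z + snd Z * snd Z = 0.

Definition BCk : BC := (BCi * BCj)%BC.
Definition e1 : BC := ((RtoBC 1 + BCk) / RtoBC 2)%BC.
Definition e2 : BC := ((RtoBC 1 - BCk) / RtoBC 2)%BC.

(** The idempotent components z1, z2 of Z = z1 e1 + z2 e2. *)
Definition idem1 (Z : BC) : C := fst Z - Ci * snd Z.
Definition idem2 (Z : BC) : C := fst Z + Ci * snd Z.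
Definition of_idem (z1 z2 : C) : BC := (CtoBC z1 * e1 + CtoBC z2 * e2)%BC.

(** ** Holomorphy *)

Definition BC_differentiable_at (X : BC -> Prop) (g : BC -> BC) (W0 : BC) : Prop :=
  exists L : BC,
    filterlim (fun W => (g W - g W0) / (W - W0))%BC
      (within (fun W => X W /\ ~ O2 (W - W0)%BC) (locally W0))
      (locally L).

Definition BC_holomorphic (X : BC -> Prop) (g : BC -> BC) : Prop :=
  forall W0 : BC, X W0 -> BC_differentiable_at X g W0.

(** ** The Bessel function *)

(** The logarithms of the two idempotent components are chosen independently. *)
Definition BCpower (log1 log2 : C -> C) (Z V : BC) : BC :=
  of_idem (Cpower log1 (idem1 Z) (idem1 V)) (Cpower log2 (idem2 Z) (idem2 V)).

(** 1 / Gamma_b *)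
Definition BCrGamma (Z : BC) : BC :=
  of_idem (CrGamma (idem1 Z)) (CrGamma (idem2 Z)).

Definition BC_Series (a : nat -> BC) : BC :=
  (C_Series (fun n => fst (a n)), C_Series (fun n => snd (a n))).

Definition BCBesselJ_term (log1 log2 : C -> C) (V Z : BC) (s : nat) : BC :=
  (RtoBC ((-1) ^ s / INR (fact s))
   * BCrGamma (V + RtoBC (INR s) + RtoBC 1)
   * BCpower log1 log2 (Z / RtoBC 2) (V + RtoBC (2 * INR s)))%BC.

Definition BCBesselJ (log1 log2 : C -> C) (V Z : BC) : BC :=
  BC_Series (BCBesselJ_term log1 log2 V Z).

(** ** Elementary checks *)

Ltac BC_unfold :=
  unfold of_idem, idem1, idem2, e1, e2, BCk, BCi, BCj, O2, RtoBC, CtoBC,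
    BCdiv, BCinv, BCminus, BCopp, BCplus, BCmult; cbn [fst snd].

Lemma RtoC2_neq_0 : RtoC 2 <> 0.
Proof. intros H; apply RtoC_inj in H; apply (Rgt_not_eq 2 0); auto with real. Qed.

Lemma Ci_sqr : Ci * Ci = - RtoC 1.
Proof. unfold Ci, Cmult, Copp, RtoC; cbn; f_equal; ring. Qed.

Lemma BCj_sqr : (BCj * BCj = - RtoBC 1)%BC.
Proof. BC_unfold; f_equal; ring. Qed.

Lemma BCinv_r (Z : BC) : ~ O2 Z -> (Z * / Z = RtoBC 1)%BC.
Proof.
intros H; unfold O2 in H; BC_unfold; f_equal; field; exact H.
Qed.

Lemma e1_val : e1 = (/ RtoC 2, Ci / RtoC 2).
Proof.
BC_unfold; f_equal; field; try split; try exact RtoC2_neq_0;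
  replace (RtoC 2 * RtoC 2 + 0 * 0) with (RtoC 2 * RtoC 2) by ring;
  apply Cmult_neq_0; exact RtoC2_neq_0.
Qed.

Lemma e2_val : e2 = (/ RtoC 2, - Ci / RtoC 2).
Proof.
BC_unfold; f_equal; field; try split; try exact RtoC2_neq_0;
  replace (RtoC 2 * RtoC 2 + 0 * 0) with (RtoC 2 * RtoC 2) by ring;
  apply Cmult_neq_0; exact RtoC2_neq_0.
Qed.

Lemma idem1_of_idem (z1 z2 : C) : idem1 (of_idem z1 z2) = z1.
Proof.
unfold of_idem; rewrite e1_val, e2_val; BC_unfold.
transitivity ((z1 + z2 - Ci * Ci * (z1 - z2)) / 2); [field; exact RtoC2_neq_0|].
rewrite Ci_sqr; field; exact RtoC2_neq_0.
Qed.

Lemma idem2_of_idem (z1 z2 : C) : idem2 (of_idem z1 z2) = z2.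
Proof.
unfold of_idem; rewrite e1_val, e2_val; BC_unfold.
transitivity ((z1 + z2 + Ci * Ci * (z1 - z2)) / 2); [field; exact RtoC2_neq_0|].
rewrite Ci_sqr; field; exact RtoC2_neq_0.
Qed.

Lemma of_idem_idem (Z : BC) : of_idem (idem1 Z) (idem2 Z) = Z.
Proof.
unfold of_idem; rewrite e1_val, e2_val; destruct Z as [l1 l2]; BC_unfold; f_equal.
- field; exact RtoC2_neq_0.
- transitivity (- (Ci * Ci) * l2); [field; exact RtoC2_neq_0|].
  rewrite Ci_sqr; ring.
Qed.

Lemma O2_idem (Z : BC) : O2 Z <-> idem1 Z * idem2 Z = 0.
Proof.
unfold O2, idem1, idem2.
replace ((fst Z - Ci * snd Z) * (fst Z + Ci * snd Z))
  with (fst Z * fst Z - Ci * Ci * (snd Z * snd Z)) by ring.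
rewrite Ci_sqr.
replace (fst Z * fst Z - - (1) * (snd Z * snd Z))
  with (fst Z * fst Z + snd Z * snd Z) by ring.
tauto.
Qed.

(* Main.v *)
(** In idempotent components the Bessel function splits into two classical Bessel
    functions, so it is enough to differentiate
    [nu |-> sum_s (-1)^s / s! * 1/Gamma (nu + s + 1) * exp ((nu + 2 s) l)] over C.
    Instead of Cauchy's formula, an algebra norm on 1-jets is used, which bounds at
    once [f], its Lipschitz constant at the base point and its quadratic Taylor
    remainder: an absolutely convergent series for this norm has a differentiable
    sum. The reciprocals of the Gauss products have successive quotients
    [1 + O (1/n^2)] for this norm, hence they converge, and to a nonzero limit off
    the poles of Gamma. The equation [1/Gamma z = z * (1/Gamma (z + 1))] then bounds
    the norm of [1/Gamma (nu + s + 1)] geometrically in [s], and the factor [1/s!]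
    makes the Bessel series converge. *)

From Stdlib Require Import Lra Lia Factorial ClassicalEpsilon FunctionalExtensionality.
Require Import Defs.

Lemma choice {A B : Type} (P : A -> B -> Prop) :
  (forall x, exists y, P x y) -> exists f, forall x, P x (f x).
Proof.
intros H; exists (fun x => proj1_sig (constructive_indefinite_description _ (H x))).
intros x; apply proj2_sig.
Qed.

(** * Complex exponential *)

Lemma Cmod_le_Rabs (x y : R) : (Cmod (x, y) <= Rabs x + Rabs y)%R.
Proof.
replace (x, y) with (RtoC x + Ci * RtoC y)
  by (unfold Ci, RtoC, Cmult, Cplus; cbn; f_equal; ring).
eapply Rle_trans; [apply Cmod_triangle|].
rewrite Cmod_mult, Cmod_Ci, !Cmod_R; lra.
Qed.

Lemma im_le_Cmod (z : C) : (Rabs (Im z) <= Cmod z)%R.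
Proof.
eapply Rle_trans; [|apply Rmax_Cmod].
apply Rmax_r.
Qed.

Lemma Cmod_minus_le (x y : C) : (Cmod (x - y) <= Cmod x + Cmod y)%R.
Proof.
rewrite <- (Cmod_opp y); apply Cmod_triangle.
Qed.

Lemma Cexp_plus (z w : C) : Cexp (z + w) = Cexp z * Cexp w.
Proof.
destruct z as [a b], w as [c d]; unfold Cexp, Cplus, Cmult; cbn.
rewrite exp_plus, cos_plus, sin_plus; f_equal; ring.
Qed.

Lemma Cexp_0 : Cexp 0 = 1.
Proof. unfold Cexp; cbn; rewrite exp_0, cos_0, sin_0; unfold RtoC; f_equal; ring. Qed.

Lemma Cexp_R (x : R) : Cexp x = exp x.
Proof. unfold Cexp, RtoC; cbn; rewrite cos_0, sin_0; f_equal; ring. Qed.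

Lemma Cexp_neq_0 (z : C) : Cexp z <> 0.
Proof.
intros H.
apply C1_nz; rewrite <- Cexp_0; replace (RtoC 0) with (z + - z) by ring.
rewrite Cexp_plus, H; ring.
Qed.

Lemma Cexp_opp (z : C) : Cexp (- z) = / Cexp z.
Proof.
transitivity (Cexp (- z) * Cexp z * / Cexp z); [field; apply Cexp_neq_0|].
rewrite <- Cexp_plus; replace (- z + z) with (RtoC 0) by ring.
rewrite Cexp_0; ring.
Qed.

Lemma Cexp_nat_mult (n : nat) (z : C) : Cexp (INR n * z) = Cexp z ^ n.
Proof.
induction n as [|n IH].
- cbn [INR Cpow]; replace (RtoC 0 * z) with (RtoC 0) by ring; apply Cexp_0.
- rewrite S_INR, RtoC_plus; cbn [Cpow]; rewrite <- IH, <- Cexp_plus; f_equal; ring.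
Qed.

Lemma exp_le (x y : R) : (x <= y -> exp x <= exp y)%R.
Proof. intros [H | ->]; [left; apply exp_increasing; exact H|lra]. Qed.

(** Mean value theorem between 0 and x. Since [K] may depend on [x], a first bound on the derivative
    can be fed in again, which yields the quadratic remainders of [exp], [cos] and [sin] below. *)
Lemma Rabs_diff_0_le (f df : R -> R) (x K : R) :
  (forall t, is_derive f t (df t)) ->
  (forall t, Rabs t <= Rabs x -> Rabs (df t) <= K)%R ->
  (Rabs (f x - f 0) <= Rabs x * K)%R.
Proof.
intros Hd HK.
destruct (MVT_gen f 0 x df) as [c [Hc ->]].
- intros; apply Hd.
- intros t _; apply continuity_pt_filterlim, @ex_derive_continuous.
  exists (df t); apply Hd.
- rewrite Rabs_mult, Rminus_0_r, Rmult_comm.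
  apply Rmult_le_compat_l; [apply Rabs_pos|]; apply HK.
  revert Hc; unfold Rmin, Rmax; destruct (Rle_dec 0 x); intros [? ?];
    [rewrite !Rabs_pos_eq by lra|rewrite !Rabs_left1 by lra]; lra.
Qed.

Lemma Rabs_exp_minus_1_le (x : R) : (Rabs (exp x - 1) <= Rabs x * exp (Rabs x))%R.
Proof.
rewrite <- exp_0 at 1; apply Rabs_diff_0_le with (df := exp).
- intros t; auto_derive; trivial; ring.
- intros t Ht; rewrite Rabs_pos_eq by (left; apply exp_pos).
  apply exp_le; pose proof (Rle_abs t); lra.
Qed.

Lemma Rabs_exp_remainder_le (x : R) :
  (Rabs (exp x - 1 - x) <= Rabs x * (Rabs x * exp (Rabs x)))%R.
Proof.
replace (exp x - 1 - x)%R with ((exp x - x) - (exp 0 - 0))%R by (rewrite exp_0; ring).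
apply Rabs_diff_0_le with (f := fun t => (exp t - t)%R) (df := fun t => (exp t - 1)%R).
- intros t; auto_derive; trivial; ring.
- intros t Ht; eapply Rle_trans; [apply Rabs_exp_minus_1_le|].
  apply Rmult_le_compat; auto using Rabs_pos, exp_le; left; apply exp_pos.
Qed.

Lemma Rabs_sin_le (x : R) : (Rabs (sin x) <= Rabs x)%R.
Proof.
rewrite <- (Rminus_0_r (sin x)), <- sin_0, <- (Rmult_1_r (Rabs x)).
apply Rabs_diff_0_le with (df := cos).
- intros t; auto_derive; trivial; ring.
- intros t _; apply Rabs_le, COS_bound.
Qed.

Lemma Rabs_cos_minus_1_le (x : R) : (Rabs (cos x - 1) <= Rabs x)%R.
Proof.
rewrite <- cos_0, <- (Rmult_1_r (Rabs x)).
apply Rabs_diff_0_le with (df := fun t => (- sin t)%R).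
- intros t; auto_derive; trivial; ring.
- intros t _; rewrite Rabs_Ropp; apply Rabs_le, SIN_bound.
Qed.

Lemma Rabs_cos_remainder_le (x : R) : (Rabs (cos x - 1) <= Rabs x * Rabs x)%R.
Proof.
rewrite <- cos_0.
apply Rabs_diff_0_le with (df := fun t => (- sin t)%R).
- intros t; auto_derive; trivial; ring.
- intros t Ht; rewrite Rabs_Ropp; pose proof (Rabs_sin_le t); lra.
Qed.

Lemma Rabs_sin_remainder_le (x : R) : (Rabs (sin x - x) <= Rabs x * Rabs x)%R.
Proof.
replace (sin x - x)%R with ((sin x - x) - (sin 0 - 0))%R by (rewrite sin_0; ring).
apply Rabs_diff_0_le with (f := fun t => (sin t - t)%R) (df := fun t => (cos t - 1)%R).
- intros t; auto_derive; trivial; ring.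
- intros t Ht; pose proof (Rabs_cos_minus_1_le t); lra.
Qed.

Lemma Cmod_Cexp (z : C) : Cmod (Cexp z) = exp (Re z).
Proof.
unfold Cexp, Cmod; cbn [fst snd].
replace ((exp (Re z) * cos (Im z)) ^ 2 + (exp (Re z) * sin (Im z)) ^ 2)%R
  with (Rsqr (exp (Re z)))
  by (transitivity (Rsqr (exp (Re z)) * (Rsqr (sin (Im z)) + Rsqr (cos (Im z))))%R;
      [rewrite sin2_cos2; ring|unfold Rsqr; ring]).
apply sqrt_Rsqr; left; apply exp_pos.
Qed.

Lemma Cmod_Cexp_le (z : C) : (Cmod (Cexp z) <= exp (Cmod z))%R.
Proof.
rewrite Cmod_Cexp.
apply exp_le; eapply Rle_trans; [apply Rle_abs|apply re_le_Cmod].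
Qed.

(** For z = x + iy the remainder has real part e^x (cos y - 1) + (e^x - 1 - x) and imaginary part
    e^x (sin y - y) + (e^x - 1) y. Each of these four terms is at most e^|z| |z|^2, whence the
    constant 4. *)
Lemma Cmod_Cexp_remainder_le (z : C) :
  (Cmod (Cexp z - 1 - z) <= 4 * exp (Cmod z) * (Cmod z * Cmod z))%R.
Proof.
pose proof (re_le_Cmod z) as Hx; pose proof (im_le_Cmod z) as Hy.
set (r := Cmod z) in *.
assert (Hr : (0 <= r)%R) by apply Cmod_ge_0.
destruct z as [x y]; cbn in Hx, Hy.
assert (He : forall t, (Rabs t <= r -> exp t <= exp r /\ exp (Rabs t) <= exp r)%R).
{ intros t Ht; split; apply exp_le; trivial; eapply Rle_trans; [apply Rle_abs|exact Ht]. }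
destruct (He x Hx) as [He1 He2].
pose proof (exp_pos x); pose proof (exp_pos r); pose proof (exp_pos (Rabs x)).
pose proof (Rabs_pos x); pose proof (Rabs_pos y).
replace (Cexp (x, y) - 1 - (x, y)) with
  ((exp x * (cos y - 1) + (exp x - 1 - x))%R, (exp x * (sin y - y) + (exp x - 1) * y)%R)
  by (unfold Cexp, Cminus, Cplus, Copp, RtoC; cbn; f_equal; ring).
eapply Rle_trans; [apply Cmod_le_Rabs|].
assert (A : forall a b, (0 <= a <= r -> 0 <= b <= r -> a * b <= r * r)%R)
  by (intros; apply Rmult_le_compat; lra).
assert (B : forall a b, (0 <= a <= exp r -> 0 <= b <= r * r -> a * b <= exp r * (r * r))%R)
  by (intros; apply Rmult_le_compat; lra).
assert (Hxx := A (Rabs x) (Rabs x) (conj (Rabs_pos _) Hx) (conj (Rabs_pos _) Hx)).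
assert (Hyy := A (Rabs y) (Rabs y) (conj (Rabs_pos _) Hy) (conj (Rabs_pos _) Hy)).
assert (Hxy := A (Rabs x) (Rabs y) (conj (Rabs_pos _) Hx) (conj (Rabs_pos _) Hy)).
assert (T1 : (Rabs (exp x * (cos y - 1)) <= exp r * (r * r))%R).
{ rewrite Rabs_mult; apply B.
  - rewrite Rabs_pos_eq; lra.
  - pose proof (Rabs_cos_remainder_le y); pose proof (Rabs_pos (cos y - 1)); lra. }
assert (T2 : (Rabs (exp x * (sin y - y)) <= exp r * (r * r))%R).
{ rewrite Rabs_mult; apply B.
  - rewrite Rabs_pos_eq; lra.
  - pose proof (Rabs_sin_remainder_le y); pose proof (Rabs_pos (sin y - y)); lra. }
assert (T3 : (Rabs (exp x - 1 - x) <= exp r * (r * r))%R).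
{ eapply Rle_trans; [apply Rabs_exp_remainder_le|].
  rewrite <- Rmult_assoc, Rmult_comm; apply B; split; try lra.
  apply Rmult_le_pos; lra. }
assert (T4 : (Rabs ((exp x - 1) * y) <= exp r * (r * r))%R).
{ rewrite Rabs_mult.
  apply Rle_trans with (exp (Rabs x) * (Rabs x * Rabs y))%R.
  - rewrite <- Rmult_assoc, (Rmult_comm (exp _)).
    apply Rmult_le_compat_r; trivial; apply Rabs_exp_minus_1_le.
  - apply B; split; try lra; apply Rmult_le_pos; lra. }
pose proof (Rabs_triang (exp x * (cos y - 1)) (exp x - 1 - x)).
pose proof (Rabs_triang (exp x * (sin y - y)) ((exp x - 1) * y)).
lra.
Qed.

Lemma Cmod_Cexp_minus_1_le (z : C) :
  (Cmod (Cexp z - 1) <= (1 + 4 * exp (Cmod z) * Cmod z) * Cmod z)%R.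
Proof.
replace (Cexp z - 1) with ((Cexp z - 1 - z) + z) by ring.
eapply Rle_trans; [apply Cmod_triangle|].
pose proof (Cmod_Cexp_remainder_le z); lra.
Qed.

(** * Functions with a first-order Taylor bound at 0 *)

(** The numbers [M] behave like an algebra norm of the 1-jet of [f] at 0 on the
    closed unit disk. *)
Definition jet_bound (f : C -> C) (d : C) (M : R) : Prop :=
  (Cmod d <= M)%R /\
  forall h : C, (Cmod h <= 1)%R ->
    (Cmod (f h) <= M)%R /\
    (Cmod (f h - f 0) <= M * Cmod h)%R /\
    (Cmod (f h - f 0 - d * h) <= M * (Cmod h * Cmod h))%R.

Lemma Cmod_0_le_1 : (Cmod 0 <= 1)%R.
Proof. rewrite Cmod_0; lra. Qed.

Lemma jet_bound_pos f d M : jet_bound f d M -> (0 <= M)%R.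
Proof. intros [H _]; pose proof (Cmod_ge_0 d); lra. Qed.

Lemma jet_bound_le f d M M' : jet_bound f d M -> (M <= M')%R -> jet_bound f d M'.
Proof.
intros [Hd Hf] HM; split; [lra|].
intros h Hh; destruct (Hf h Hh) as (H1 & H2 & H3); pose proof (Cmod_ge_0 h).
repeat split; [lra| |]; (eapply Rle_trans; [eassumption|]);
  apply Rmult_le_compat_r; trivial; apply Rmult_le_pos; trivial.
Qed.

Lemma jet_bound_ext f g d M :
  (forall h, (Cmod h <= 1)%R -> f h = g h) -> jet_bound f d M -> jet_bound g d M.
Proof.
intros E [Hd Hf]; split; trivial.
intros h Hh; rewrite <- !E by (trivial; apply Cmod_0_le_1); auto.
Qed.

Lemma jet_bound_const c : jet_bound (fun _ => c) 0 (Cmod c).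
Proof.
pose proof (Cmod_ge_0 c).
split; [rewrite Cmod_0; trivial|].
intros h Hh; pose proof (Cmod_ge_0 h).
replace (c - c - 0 * h) with (RtoC 0) by ring; replace (c - c) with (RtoC 0) by ring.
rewrite Cmod_0; repeat split; [lra| |]; repeat apply Rmult_le_pos; trivial.
Qed.

Lemma jet_bound_id w : jet_bound (fun h => w + h) 1 (1 + Cmod w).
Proof.
pose proof (Cmod_ge_0 w).
split; [rewrite Cmod_1; lra|].
intros h Hh; pose proof (Cmod_ge_0 h).
replace (w + h - (w + 0) - 1 * h) with (RtoC 0) by ring.
replace (w + h - (w + 0)) with h by ring.
rewrite Cmod_0; repeat split.
- eapply Rle_trans; [apply Cmod_triangle|lra].
- rewrite <- (Rmult_1_l (Cmod h)) at 1; apply Rmult_le_compat_r; lra.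
- repeat apply Rmult_le_pos; lra.
Qed.

Lemma jet_bound_plus f g d e M N :
  jet_bound f d M -> jet_bound g e N ->
  jet_bound (fun h => f h + g h) (d + e) (M + N).
Proof.
intros [Hd Hf] [He Hg]; split.
- eapply Rle_trans; [apply Cmod_triangle|lra].
- intros h Hh.
  destruct (Hf h Hh) as (F1 & F2 & F3), (Hg h Hh) as (G1 & G2 & G3).
  repeat split.
  + eapply Rle_trans; [apply Cmod_triangle|lra].
  + replace (f h + g h - (f 0 + g 0)) with ((f h - f 0) + (g h - g 0)) by ring.
    eapply Rle_trans; [apply Cmod_triangle|lra].
  + replace (f h + g h - (f 0 + g 0) - (d + e) * h)
      with ((f h - f 0 - d * h) + (g h - g 0 - e * h)) by ring.
    eapply Rle_trans; [apply Cmod_triangle|lra].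
Qed.

Lemma jet_bound_scal c f d M :
  jet_bound f d M -> jet_bound (fun h => c * f h) (c * d) (Cmod c * M).
Proof.
intros [Hd Hf]; pose proof (Cmod_ge_0 c); split.
- rewrite Cmod_mult; apply Rmult_le_compat_l; trivial.
- intros h Hh; destruct (Hf h Hh) as (F1 & F2 & F3).
  replace (c * f h - c * f 0 - c * d * h) with (c * (f h - f 0 - d * h)) by ring.
  replace (c * f h - c * f 0) with (c * (f h - f 0)) by ring.
  rewrite !Cmod_mult, !Rmult_assoc.
  repeat split; apply Rmult_le_compat_l; trivial.
Qed.

(** By the Leibniz rule the derivative and the increment are sums of two products, and the
    second-order remainder is a sum of three, each at most M N |h|^2. The norm is thus
    submultiplicative up to the factor 3. *)
Lemma jet_bound_mult f g d e M N :
  jet_bound f d M -> jet_bound g e N ->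
  jet_bound (fun h => f h * g h) (f 0 * e + d * g 0) (3 * (M * N)).
Proof.
intros Jf Jg.
pose proof (jet_bound_pos _ _ _ Jf) as HM; pose proof (jet_bound_pos _ _ _ Jg) as HN.
destruct Jf as [Hd Hf], Jg as [He Hg].
pose proof (Rmult_le_pos _ _ HM HN).
(* [a] and [b] record the order in h of the two factors: 1, |h| or |h|^2. *)
assert (P : forall (a b : R) (u v : C),
  (Cmod u <= M * a -> Cmod v <= N * b -> Cmod (u * v) <= M * N * (a * b))%R).
{ intros a b u v Hu Hv; rewrite Cmod_mult.
  replace (M * N * (a * b))%R with ((M * a) * (N * b))%R by ring.
  apply Rmult_le_compat; auto using Cmod_ge_0. }
destruct (Hf 0 Cmod_0_le_1) as (f0 & _), (Hg 0 Cmod_0_le_1) as (g0 & _).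
split.
- eapply Rle_trans; [apply Cmod_triangle|].
  assert (Cmod (f 0 * e)%C <= M * N * (1 * 1))%R by (apply P; lra).
  assert (Cmod (d * g 0)%C <= M * N * (1 * 1))%R by (apply P; lra).
  lra.
- intros h Hh; pose proof (Cmod_ge_0 h) as Hh0.
  destruct (Hf h Hh) as (F1 & F2 & F3), (Hg h Hh) as (G1 & G2 & G3).
  set (r := Cmod h) in *.
  pose proof (Rmult_le_pos _ _ H Hh0).
  repeat split.
  + assert (Cmod (f h * g h)%C <= M * N * (1 * 1))%R by (apply P; lra).
    lra.
  + replace (f h * g h - f 0 * g 0) with (f h * (g h - g 0) + (f h - f 0) * g 0) by ring.
    eapply Rle_trans; [apply Cmod_triangle|].
    assert (Cmod (f h * (g h - g 0))%C <= M * N * (1 * r))%R by (apply P; lra).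
    assert (Cmod ((f h - f 0) * g 0)%C <= M * N * (r * 1))%R by (apply P; lra).
    lra.
  + replace (f h * g h - f 0 * g 0 - (f 0 * e + d * g 0) * h)
      with (f h * (g h - g 0 - e * h) + (f h - f 0 - d * h) * g 0
        + (f h - f 0) * (e * h)) by ring.
    eapply Rle_trans; [apply Cmod_triangle|].
    eapply Rle_trans; [apply Rplus_le_compat_r, Cmod_triangle|].
    assert (Cmod (e * h) <= N * r)%R
      by (rewrite Cmod_mult; apply Rmult_le_compat_r; trivial).
    assert (Cmod (f h * (g h - g 0 - e * h))%C <= M * N * (1 * (r * r)))%R
      by (apply P; lra).
    assert (Cmod ((f h - f 0 - d * h) * g 0)%C <= M * N * (r * r * 1))%R
      by (apply P; lra).
    assert (Cmod ((f h - f 0) * (e * h))%C <= M * N * (r * r))%R by (apply P; lra).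
    lra.
Qed.

(** The increment is -h / (a (a + h)) and the remainder h^2 / (a^2 (a + h)); all denominators have
    modulus at least 1, so no constant is lost. *)
Lemma jet_bound_inv a :
  (forall h, (Cmod h <= 1 -> 1 <= Cmod (a + h))%R) ->
  jet_bound (fun h => / (a + h)) (- / (a * a)) 1.
Proof.
intros Ha.
assert (Hnz : forall h, (Cmod h <= 1)%R -> a + h <> 0).
{ intros h Hh E; specialize (Ha h Hh); rewrite E, Cmod_0 in Ha; lra. }
assert (Ha0 : (1 <= Cmod a)%R)
  by (rewrite <- (Cplus_0_r a); apply Ha, Cmod_0_le_1).
assert (Hn0 : a <> 0) by (rewrite <- (Cplus_0_r a); apply Hnz, Cmod_0_le_1).
assert (I : forall x, (1 <= Cmod x -> Cmod (/ x) <= 1)%R).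
{ intros x Hx; assert (x <> 0) by (intros ->; rewrite Cmod_0 in Hx; lra).
  rewrite Cmod_inv, <- Rinv_1 by trivial; apply Rinv_le_contravar; lra. }
assert (P : forall u v, (Cmod u <= 1 -> Cmod (v * u) <= 1 * Cmod v)%R).
{ intros u v Hu; rewrite Cmod_mult, Rmult_comm.
  apply Rmult_le_compat_r; trivial; apply Cmod_ge_0. }
assert (Q : forall x y, (1 <= Cmod x -> 1 <= Cmod y -> 1 <= Cmod (x * y))%R).
{ intros x y Hx Hy; rewrite Cmod_mult, <- (Rmult_1_l 1); apply Rmult_le_compat; lra. }
split.
- rewrite Cmod_opp; auto.
- intros h Hh; pose proof (Hnz h Hh); pose proof (Ha h Hh).
  repeat split; auto.
  + replace (/ (a + h) - / (a + 0)) with (- h * / (a * (a + h)))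
      by (rewrite Cplus_0_r; field; auto).
    rewrite <- (Cmod_opp h); apply P; auto.
  + replace (/ (a + h) - / (a + 0) - - / (a * a) * h)
      with (h * h * / (a * a * (a + h))) by (rewrite Cplus_0_r; field; auto).
    rewrite <- Cmod_mult; apply P; auto.
Qed.

(** What matters is the factor |c|^2 with [K] uniform in [c]: in the steps of the Gauss product c is
    of order 1/n, and this makes their norms summable. *)
Lemma jet_bound_exp_remainder (w : C) (B : R) :
  exists K : R, (0 <= K)%R /\ forall c : C, (Cmod c <= B)%R ->
  exists d, jet_bound (fun h => Cexp (c * (w + h)) - 1 - c * (w + h)) d
    (K * (Cmod c * Cmod c)).
Proof.
set (r := (1 + Cmod w)%R); set (E := exp (Rabs B * r)).
assert (Hr : (1 <= r)%R) by (unfold r; pose proof (Cmod_ge_0 w); lra).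
assert (HE : (0 < E)%R) by apply exp_pos.
set (L := (1 + 4 * E * (Rabs B * r))%R).
assert (HL : (0 < L)%R).
{ assert (0 <= E * (Rabs B * r))%R; [|unfold L; lra].
  repeat apply Rmult_le_pos; try lra; apply Rabs_pos. }
(* The three summands control the value, the second-order remainder and the derivative. [E] bounds
   e^(cw), and [L] bounds (e^(cw) - 1) / (cw). *)
exists (4 * E * (r * r) + E * (4 * E) + L * r)%R; split.
{ repeat apply Rplus_le_le_0_compat; repeat apply Rmult_le_pos; lra. }
intros c Hc; exists (c * (Cexp (c * w) - 1)).
pose proof (Cmod_ge_0 c) as Hc0.
assert (X : forall z, (Cmod z <= r -> Cmod (c * z) <= Rabs B * r)%R).
{ intros z Hz; rewrite Cmod_mult; apply Rmult_le_compat; auto using Cmod_ge_0.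
  pose proof (Rle_abs B); lra. }
assert (X2 : forall z, (Cmod z <= r ->
  Cmod (Cexp (c * z) - 1 - c * z) <= 4 * E * (Cmod c * Cmod c * (Cmod z * Cmod z)))%R).
{ intros z Hz; eapply Rle_trans; [apply Cmod_Cexp_remainder_le|].
  apply Rmult_le_compat.
  - pose proof (exp_pos (Cmod (c * z))); lra.
  - apply Rmult_le_pos; apply Cmod_ge_0.
  - apply Rmult_le_compat_l; [lra|]; apply exp_le; auto.
  - rewrite Cmod_mult; right; ring. }
assert (Hw : (Cmod w <= r)%R) by (unfold r; lra).
assert (W0 : (Cmod (Cexp (c * w)) <= E)%R)
  by (eapply Rle_trans; [apply Cmod_Cexp_le|]; apply exp_le; auto).
assert (W1 : (Cmod (Cexp (c * w) - 1) <= L * (Cmod c * r))%R).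
{ eapply Rle_trans; [apply Cmod_Cexp_minus_1_le|].
  assert (Hcw : (Cmod (c * w) <= Cmod c * r)%R)
    by (rewrite Cmod_mult; apply Rmult_le_compat_l; trivial).
  apply Rmult_le_compat; auto using Cmod_ge_0.
  - pose proof (exp_pos (Cmod (c * w))); pose proof (Cmod_ge_0 (c * w)).
    assert (0 <= exp (Cmod (c * w)) * Cmod (c * w))%R; [|lra].
    apply Rmult_le_pos; lra.
  - apply Rplus_le_compat_l, Rmult_le_compat; auto using Cmod_ge_0.
    + pose proof (exp_pos (Cmod (c * w))); lra.
    + apply Rmult_le_compat_l; [lra|]; apply exp_le; auto. }
assert (c2 : (0 <= Cmod c * Cmod c)%R) by (apply Rmult_le_pos; trivial).
assert (K1 : (0 <= 4 * E * (r * r) * (Cmod c * Cmod c))%R)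
  by (repeat apply Rmult_le_pos; lra).
assert (K2 : (0 <= E * (4 * E) * (Cmod c * Cmod c))%R)
  by (repeat apply Rmult_le_pos; lra).
assert (K3 : (0 <= L * r * (Cmod c * Cmod c))%R)
  by (repeat apply Rmult_le_pos; lra).
assert (W2 : (Cmod (c * (Cexp (c * w) - 1)) <= L * r * (Cmod c * Cmod c))%R).
{ rewrite Cmod_mult; apply Rle_trans with (Cmod c * (L * (Cmod c * r)))%R;
    [apply Rmult_le_compat_l; trivial|right; ring]. }
split; [lra|].
intros h Hh; pose proof (Cmod_ge_0 h) as Hh0.
set (e := Cexp (c * h) - 1 - c * h).
assert (He : (Cmod (Cexp (c * w) * e)
  <= E * (4 * E) * (Cmod c * Cmod c) * (Cmod h * Cmod h))%R).
{ rewrite Cmod_mult, !Rmult_assoc.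
  apply Rmult_le_compat; auto using Cmod_ge_0.
  eapply Rle_trans; [apply X2; lra|right; ring]. }
(* By e^(c(w+h)) = e^(cw) e^(ch), the remainder at w is e^(cw) times the remainder of the
   exponential at ch. *)
assert (D : Cexp (c * (w + h)) - 1 - c * (w + h) - (Cexp (c * (w + 0)) - 1 - c * (w + 0))
  - c * (Cexp (c * w) - 1) * h = Cexp (c * w) * e).
{ unfold e; rewrite Cmult_plus_distr_l, Cexp_plus, Cplus_0_r; ring. }
assert (Hhh : (Cmod h * Cmod h <= Cmod h)%R).
{ rewrite <- (Rmult_1_l (Cmod h)) at 3; apply Rmult_le_compat_r; trivial. }
repeat split.
- assert (Hwh : (Cmod (w + h) <= r)%R)
    by (eapply Rle_trans; [apply Cmod_triangle|unfold r; lra]).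
  eapply Rle_trans; [apply X2; trivial|].
  assert (Cmod (w + h) * Cmod (w + h) <= r * r)%R
    by (apply Rmult_le_compat; auto using Cmod_ge_0).
  assert (4 * E * (Cmod c * Cmod c * (Cmod (w + h) * Cmod (w + h)))
    <= 4 * E * (Cmod c * Cmod c * (r * r)))%R; [|lra].
  repeat apply Rmult_le_compat_l; lra.
- replace (Cexp (c * (w + h)) - 1 - c * (w + h) - (Cexp (c * (w + 0)) - 1 - c * (w + 0)))
    with (Cexp (c * w) * e + c * (Cexp (c * w) - 1) * h)
    by (rewrite <- D; ring).
  eapply Rle_trans; [apply Cmod_triangle|].
  rewrite (Cmod_mult _ h).
  pose proof (Rmult_le_compat_r _ _ _ Hh0 W2).
  pose proof (Rmult_le_compat_l _ _ _ K2 Hhh).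
  pose proof (Rmult_le_pos _ _ K1 Hh0).
  lra.
- rewrite D.
  assert (h2 : (0 <= Cmod h * Cmod h)%R) by (apply Rmult_le_pos; trivial).
  pose proof (Rmult_le_pos _ _ K1 h2); pose proof (Rmult_le_pos _ _ K3 h2).
  lra.
Qed.

Lemma jet_bound_Cexp (c w : C) : exists d M, jet_bound (fun h => Cexp (c * (w + h))) d M.
Proof.
destruct (jet_bound_exp_remainder w (Cmod c)) as (K & _ & HK).
destruct (HK c (Rle_refl _)) as [d Hd].
eexists; eexists.
eapply jet_bound_ext; cycle 1.
- eapply jet_bound_plus; [exact Hd|].
  eapply jet_bound_plus; [apply (jet_bound_const 1)|].
  apply (jet_bound_scal c), (jet_bound_id w).
- intros h _; cbn; ring.
Qed.

(** * Series of complex numbers and of functions with jet bounds *)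

Lemma Cmod_series_le (a : nat -> C) (b : nat -> R) (l : C) :
  is_series a l -> (forall n, Cmod (a n) <= b n)%R -> ex_series b ->
  (Cmod l <= Series b)%R.
Proof.
intros Ha Hab Hb.
assert (H1 : is_lim_seq (fun n => Cmod (sum_n a n)) (Cmod l)).
{ eapply filterlim_comp; [exact Ha|].
  exact (filterlim_norm (V := C_NormedModule) l). }
assert (H2 : is_lim_seq (sum_n b) (Series b)) by (apply Series_correct; trivial).
refine (is_lim_seq_le _ _ _ _ _ H1 H2); intros n.
eapply Rle_trans; [apply (norm_sum_n_m (V := C_NormedModule))|].
apply sum_n_m_le; exact Hab.
Qed.

Lemma C_Series_correct (a : nat -> C) (b : nat -> R) :
  (forall n, Cmod (a n) <= b n)%R -> ex_series b -> is_series a (C_Series a).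
Proof.
intros Hab Hb.
destruct (ex_series_le (V := C_CompleteNormedModule) a b Hab Hb) as [l Hl].
replace (C_Series a) with l; trivial.
symmetry; apply (iota_filterlim_locally (V := C_CompleteNormedModule)), Hl.
Qed.

Lemma C_Series_unique (a : nat -> C) (l : C) : is_series a l -> C_Series a = l.
Proof. apply (iota_filterlim_locally (V := C_CompleteNormedModule)). Qed.

Lemma ex_series_scal_R (M : nat -> R) (c : R) :
  ex_series M -> ex_series (fun n => M n * c)%R.
Proof. intros [l Hl]; exists (l * c)%R; apply is_series_scal_r, Hl. Qed.

Lemma Series_scal_R (M : nat -> R) (c : R) :
  ex_series M -> Series (fun n => M n * c)%R = (Series M * c)%R.
Proof. intros H; apply is_series_unique, is_series_scal_r, Series_correct, H. Qed.

Lemma jet_bound_is_series (f : nat -> C -> C) (d : nat -> C) (M : nat -> R) (h : C) :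
  (forall n, jet_bound (f n) (d n) (M n)) -> ex_series M -> (Cmod h <= 1)%R ->
  is_series (fun n => f n h) (C_Series (fun n => f n h)).
Proof. intros J HM Hh; apply C_Series_correct with M; trivial; intros n; apply J, Hh. Qed.

(** Values, increments and second-order remainders of the sum are the sums of those of the terms, so
    every inequality in [jet_bound] passes to the limit. No uniform convergence argument or contour
    integral is required. *)
Lemma jet_bound_series (f : nat -> C -> C) (d : nat -> C) (M : nat -> R) :
  (forall n, jet_bound (f n) (d n) (M n)) -> ex_series M ->
  jet_bound (fun h => C_Series (fun n => f n h)) (C_Series d) (Series M).
Proof.
intros J HM.
assert (Hd : is_series d (C_Series d))
  by (apply C_Series_correct with M; trivial; intros n; apply J).
split; [apply (Cmod_series_le d); trivial; intros n; apply J|].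
intros h Hh.
pose proof (jet_bound_is_series f d M h J HM Hh) as Sh.
pose proof (jet_bound_is_series f d M 0 J HM Cmod_0_le_1) as S0.
pose proof (is_series_minus (V := C_NormedModule) _ _ _ _ Sh S0) as S1.
pose proof (is_series_scal (V := C_NormedModule) h _ _ Hd) as Sd.
pose proof (is_series_minus (V := C_NormedModule) _ _ _ _ S1 Sd) as S2.
repeat split.
- apply (Cmod_series_le _ _ _ Sh); trivial; intros n; apply J, Hh.
- rewrite <- Series_scal_R by trivial.
  apply (Cmod_series_le _ _ _ S1); [|apply ex_series_scal_R; trivial].
  intros n; apply J, Hh.
- rewrite <- Series_scal_R, (Cmult_comm _ h) by trivial.
  apply (Cmod_series_le _ _ _ S2); [|apply ex_series_scal_R; trivial].
  intros n; destruct (J n) as [_ Jn].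
  replace (plus _ _) with (f n h - f n 0 - d n * h) by (rewrite Cmult_comm; reflexivity).
  apply Jn, Hh.
Qed.

(** * Complex limits along a filter *)

Section C_limits.
Context {T : Type} {F : (T -> Prop) -> Prop} {FF : Filter F}.

(** [C_UniformSpace] carries the product topology of the plane, whereas the modulus gives the balls
    of [C_AbsRing]; [locally_C] identifies their neighbourhoods. *)
Lemma C_filterlim_Cmod (u : T -> C) (l : C) :
  filterlim u F (locally (T := C_UniformSpace) l) <->
  forall eps : R, (0 < eps)%R -> F (fun n => (Cmod (u n - l) < eps)%R).
Proof.
assert (E : filterlim u F (locally (T := C_UniformSpace) l) <->
    filterlim u F (locally (T := AbsRing_UniformSpace C_AbsRing) l)).
{ split; intros H P HP; apply H, locally_C, HP. }
refine (iff_trans E (iff_trans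
  (filterlim_locally (U := AbsRing_UniformSpace C_AbsRing) u l) _)); split; intros H eps.
- intros Heps; exact (H (mkposreal eps Heps)).
- exact (H eps (cond_pos eps)).
Qed.

Lemma C_filterlim_mult (u v : T -> C) (l k : C) :
  filterlim u F (locally (T := C_UniformSpace) l) -> filterlim v F (locally (T := C_UniformSpace) k) ->
  filterlim (fun n => u n * v n) F (locally (T := C_UniformSpace) (l * k)).
Proof.
assert (E : forall (w : T -> C) (m : C), filterlim w F (locally (T := C_UniformSpace) m) <->
    filterlim w F (locally (T := AbsRing_UniformSpace C_AbsRing) m)).
{ split; intros H P HP; apply H, locally_C, HP. }
rewrite !E; intros Hu Hv.
apply (filterlim_comp_2 _ _ Cmult Hu Hv (filterlim_mult (K := C_AbsRing) l k)).
Qed.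

Lemma C_filterlim_inv (u : T -> C) (l : C) :
  l <> 0 -> filterlim u F (locally (T := C_UniformSpace) l) ->
  filterlim (fun n => / u n) F (locally (T := C_UniformSpace) (/ l)).
Proof.
intros Hl Hu; apply C_filterlim_Cmod; intros eps Heps.
apply Cmod_gt_0 in Hl as Hl'.
(* Closeness within |l|/2 keeps |u n| above |l|/2; then |1/u n - 1/l| = |u n - l| / (|u n| |l|) is
   below eps once |u n - l| < eps |l|^2 / 2. *)
assert (H1 := proj1 (C_filterlim_Cmod _ _) Hu (Cmod l / 2)%R ltac:(lra)).
assert (H2 := proj1 (C_filterlim_Cmod _ _) Hu (eps * (Cmod l * Cmod l / 2))%R
  ltac:(apply Rmult_lt_0_compat; [lra|]; pose proof (Rmult_lt_0_compat _ _ Hl' Hl'); lra)).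
generalize (filter_and _ _ H1 H2); apply filter_imp; clear H1 H2.
intros n [H1 H2].
assert (Hn : (Cmod l / 2 < Cmod (u n))%R).
{ pose proof (Cmod_triangle (u n) (- (u n - l))).
  replace (u n + - (u n - l)) with l in H by ring.
  rewrite Cmod_opp in H; lra. }
assert (Hn0 : u n <> 0) by (intros E; rewrite E, Cmod_0 in Hn; lra).
replace (/ u n - / l) with (- ((u n - l) * / (u n * l))) by (field; auto).
rewrite Cmod_opp, Cmod_mult, Cmod_inv by (apply Cmult_neq_0; trivial).
rewrite Cmod_mult.
assert (P : (0 < Cmod (u n) * Cmod l)%R) by (apply Rmult_lt_0_compat; lra).
apply Rmult_lt_reg_r with (1 := P).
rewrite Rmult_assoc, Rinv_l, Rmult_1_r by lra.
eapply Rlt_le_trans; [exact H2|].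
apply Rmult_le_compat_l; [lra|].
replace (Cmod l * Cmod l / 2)%R with (Cmod l / 2 * Cmod l)%R by lra.
apply Rmult_le_compat_r; lra.
Qed.

End C_limits.

Lemma C_lim_seq_correct (u : nat -> C) (l : C) :
  filterlim u eventually (locally (T := C_UniformSpace) l) -> C_lim_seq u = l.
Proof. apply (iota_filterlim_locally (V := C_CompleteNormedModule)). Qed.

(** * Infinite products *)

(** This stands in for 1/n^2 because it telescopes: its partial sums and tails are explicit. *)
Definition inv_prod (n : nat) : R := (/ ((INR n + 1) * (INR n + 2)))%R.

Lemma inv_prod_pos n : (0 < inv_prod n)%R.
Proof.
apply Rinv_0_lt_compat; pose proof (pos_INR n); apply Rmult_lt_0_compat; lra.
Qed.

Lemma inv_prod_telescope n : inv_prod n = (/ (INR n + 1) - / (INR (S n) + 1))%R.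
Proof. unfold inv_prod; rewrite S_INR; pose proof (pos_INR n); field; lra. Qed.

Lemma ex_series_inv_prod : ex_series inv_prod.
Proof.
assert (S1 : forall n, sum_n inv_prod n = (1 - / (INR (S n) + 1))%R).
{ induction n as [|n IH].
  - rewrite sum_O, inv_prod_telescope; cbn; lra.
  - rewrite sum_Sn, IH, (inv_prod_telescope (S n)); unfold plus; cbn -[INR]; lra. }
destruct (ex_finite_lim_seq_incr (sum_n inv_prod) 1) as [l Hl].
- intros n; rewrite sum_Sn; unfold plus; cbn; pose proof (inv_prod_pos (S n)); lra.
- intros n; rewrite S1.
  assert (0 < / (INR (S n) + 1))%R; [|lra].
  apply Rinv_0_lt_compat; pose proof (pos_INR (S n)); lra.
- exists l; exact Hl.
Qed.

Section Infinite_product.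
Variables (G v : nat -> C -> C) (K : R).
Hypothesis HK : (0 <= K)%R.
Hypothesis G0 : exists d M, jet_bound (G 0) d M.
Hypothesis GS : forall n h, (Cmod h <= 1)%R -> G (S n) h = G n h * (1 + v n h).
Hypothesis Hv : forall n, exists d, jet_bound (v n) d (K * inv_prod n).

(** The 1-jet norm of [G n] is multiplied by at most [1 + 3 K inv_prod n] at each
    step, and the product of these factors is at most [exp (3 K)]. *)
Lemma product_bounded : exists M, forall n, exists d, jet_bound (G n) d M.
Proof.
destruct G0 as (d0 & M0 & J0).
pose proof (jet_bound_pos _ _ _ J0) as HM0.
exists (M0 * exp (3 * K))%R.
(* The factor 1 - 1/(n+1) is the sum of [inv_prod k] over k < n. With it the induction closes by 1 +
   x <= e^x; bounding it by 1 afterwards gives a constant uniform in n. *)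
assert (B : forall n, exists d,
  jet_bound (G n) d (M0 * exp (3 * K * (1 - / (INR n + 1))))%R).
{ induction n as [|n [d J]].
  - exists d0; apply jet_bound_le with (1 := J0).
    cbn [INR]; replace (3 * K * (1 - / (0 + 1)))%R with 0%R by field.
    rewrite exp_0; lra.
  - destruct (Hv n) as [e Je].
    eexists; eapply jet_bound_ext;
      [|eapply jet_bound_le; [exact (jet_bound_plus _ _ _ _ _ _ J
         (jet_bound_mult _ _ _ _ _ _ J Je))|]].
    + intros h Hh; rewrite GS by trivial; ring.
    + set (a := exp (3 * K * (1 - / (INR n + 1)))).
      replace (3 * K * (1 - / (INR (S n) + 1)))%R
        with (3 * K * (1 - / (INR n + 1)) + 3 * K * inv_prod n)%R
        by (rewrite inv_prod_telescope; ring).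
      rewrite exp_plus; fold a.
      assert (0 <= M0 * a)%R by (apply Rmult_le_pos; [trivial|left; apply exp_pos]).
      pose proof (exp_ineq1_le (3 * K * inv_prod n)) as E.
      pose proof (Rmult_le_compat_l _ _ _ H E); lra. }
intros n; destruct (B n) as [d J]; exists d; apply jet_bound_le with (1 := J).
apply Rmult_le_compat_l; trivial; apply exp_le.
assert (0 < / (INR n + 1))%R
  by (apply Rinv_0_lt_compat; pose proof (pos_INR n); lra).
assert (0 <= 3 * K * / (INR n + 1))%R by (repeat apply Rmult_le_pos; lra).
lra.
Qed.

(** With all [G n] bounded by M in norm, the differences G (n+1) - G n = G n * v n have norm at most
    3 M K [inv_prod n]. The limit is therefore [G 0] plus an absolutely convergent series of
    jets. *)
Lemma product_converges :
  exists L d M, jet_bound L d M /\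
  forall h, (Cmod h <= 1)%R -> filterlim (fun n => G n h) eventually (locally (T := C_UniformSpace) (L h)).
Proof.
destruct product_bounded as [M HM].
destruct (choice (fun n d => jet_bound (fun h => G n h * v n h) d (inv_prod n * (3 * (M * K)))))
  as [d Hd].
{ intros n; destruct (HM n) as [d J], (Hv n) as [e Je].
  eexists; eapply jet_bound_le; [exact (jet_bound_mult _ _ _ _ _ _ J Je)|right; ring]. }
assert (HS : ex_series (fun n => inv_prod n * (3 * (M * K)))%R)
  by (apply ex_series_scal_R, ex_series_inv_prod).
destruct G0 as (d0 & M0 & J0).
eexists; eexists; eexists; split;
  [exact (jet_bound_plus _ _ _ _ _ _ J0 (jet_bound_series _ _ _ Hd HS))|].
intros h Hh; cbv beta.
pose proof (jet_bound_is_series _ _ _ h Hd HS Hh) as Sh.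
assert (E : forall n, G 0 h + sum_n (fun k => G k h * v k h) n = G (S n) h).
{ induction n as [|n IH].
  - rewrite sum_O, GS by trivial; ring.
  - rewrite sum_Sn, (GS (S n)), <- IH by trivial; unfold plus; cbn.
    ring. }
apply C_filterlim_Cmod; intros eps Heps.
destruct (proj1 (C_filterlim_Cmod _ _) Sh eps Heps) as [N HN].
(* The partial sum up to index n gives [G (S n)], so the rank shifts by one. *)
exists (S N); intros [|n] Hn; [lia|].
rewrite <- E.
replace (G 0 h + _ - _) with (sum_n (fun k => G k h * v k h) n
    - C_Series (fun k => G k h * v k h)) by ring.
apply HN; lia.
Qed.

(** If N >= 2K, the numbers K [inv_prod k] with k >= N add up to at most 1/2. Since a product of
    factors 1 - c_k is at least 1 minus the sum of the c_k, the modulus never falls below half of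
    its value at rank N. *)
Lemma product_neq_0 (l : C) :
  (forall n, G n 0 <> 0) ->
  filterlim (fun n => G n 0) eventually (locally (T := C_UniformSpace) l) -> l <> 0.
Proof.
intros Hnz Hl El; subst l.
assert (HN : exists N : nat, (2 * K <= INR N)%R).
{ destruct (nfloor_ex (2 * K)) as [N HN]; [lra|].
  exists (S N); rewrite S_INR; lra. }
destruct HN as [N HN].
pose proof (pos_INR N) as HN0.
assert (HG := proj1 (Cmod_gt_0 _) (Hnz N)).
assert (HI : (K * / (INR N + 1) <= / 2)%R).
{ apply Rmult_le_reg_r with (INR N + 1)%R; [lra|].
  rewrite Rmult_assoc, Rinv_l by lra; lra. }
assert (B : forall m, (Cmod (G N 0) * (1 - K * (/ (INR N + 1) - / (INR (N + m) + 1)))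
  <= Cmod (G (N + m)%nat 0))%R).
{ induction m as [|m IH].
  - rewrite Nat.add_0_r; lra.
  - rewrite Nat.add_succ_r, GS, Cmod_mult by apply Cmod_0_le_1.
    set (c := (K * inv_prod (N + m))%R).
    assert (Hc : (Cmod (v (N + m)%nat 0) <= c)%R)
      by (destruct (Hv (N + m)) as (? & _ & J); apply J, Cmod_0_le_1).
    assert (Hc' : (1 - c <= Cmod (1 + v (N + m)%nat 0))%R).
    { pose proof (Cmod_triangle (1 + v (N + m)%nat 0) (- v (N + m)%nat 0)) as T.
      replace (1 + v (N + m)%nat 0 + - v (N + m)%nat 0) with (RtoC 1) in T by ring.
      rewrite Cmod_1, Cmod_opp in T; lra. }
    (* [t] is the telescoped sum of K [inv_prod k] for N <= k < N + m. The induction rests on (1 -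
       t)(1 - c) >= 1 - (t + c). *)
    set (t := (K * (/ (INR N + 1) - / (INR (N + m) + 1)))%R) in *.
    assert (Et : (K * (/ (INR N + 1) - / (INR (S (N + m)) + 1)) = t + c)%R)
      by (unfold t, c; rewrite inv_prod_telescope; ring).
    assert (Hle : (INR N <= INR (N + m))%R) by (apply le_INR; lia).
    assert (Ht : (0 <= t)%R).
    { apply Rmult_le_pos; trivial.
      assert (/ (INR (N + m) + 1) <= / (INR N + 1))%R
        by (apply Rinv_le_contravar; lra); lra. }
    assert (Hc0 : (0 <= c)%R)
      by (apply Rmult_le_pos; trivial; left; apply inv_prod_pos).
    assert (Htc : (t + c <= / 2)%R).
    { rewrite <- Et; assert (0 < / (INR (S (N + m)) + 1))%R
        by (apply Rinv_0_lt_compat; pose proof (pos_INR (S (N + m))); lra).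
      assert (0 <= K * / (INR (S (N + m)) + 1))%R by (apply Rmult_le_pos; lra). lra. }
    rewrite Et.
    apply Rle_trans with (Cmod (G N 0%C) * (1 - t) * (1 - c))%R.
    + rewrite Rmult_assoc; apply Rmult_le_compat_l; [lra|].
      pose proof (Rmult_le_pos _ _ Ht Hc0); lra.
    + apply Rmult_le_compat; trivial; [apply Rmult_le_pos|]; lra. }
destruct (proj1 (C_filterlim_Cmod _ _) Hl (Cmod (G N 0) / 2)%R) as [n Hn]; [lra|].
specialize (Hn (N + n)%nat ltac:(lia)); specialize (B n).
replace (G (N + n)%nat 0 - 0) with (G (N + n)%nat 0) in Hn by ring.
assert (0 < / (INR (N + n) + 1))%R
  by (apply Rinv_0_lt_compat; pose proof (pos_INR (N + n)); lra).
assert (0 <= K * / (INR (N + n) + 1))%R by (apply Rmult_le_pos; lra).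
assert (Cmod (G N 0%C) * / 2
  <= Cmod (G N 0%C) * (1 - K * (/ (INR N + 1) - / (INR (N + n) + 1))))%R
  by (apply Rmult_le_compat_l; lra).
lra.
Qed.

End Infinite_product.

(** * The reciprocal of the Gamma function *)

Lemma ln_le_minus_1 (x : R) : (0 < x -> ln x <= x - 1)%R.
Proof. intros Hx; pose proof (exp_ineq1_le (ln x)) as H; rewrite exp_ln in H; lra. Qed.

(** The reciprocal of Gauss' product, z (z + 1) ... (z + n) n^(-z) / n!, which makes sense at the
    poles of Gamma as well. *)
Definition rgauss (z : C) (n : nat) : C :=
  rising z n * Cexp (- (z * ln (INR n))) * / INR (fact n).

Definition ln_step (n : nat) : R := (ln (INR (S (S n))) - ln (INR (S n)))%R.

(** The quotient of the reciprocal products of ranks n + 2 and n + 1, minus 1. Ranks start at 1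
    because n^z has no meaning at n = 0. *)
Definition rgauss_step (n : nat) (z : C) : C :=
  (1 + RtoC (/ (INR n + 2)) * z) * Cexp (RtoC (- ln_step n) * z) - 1.

Lemma RtoC_INR_neq_0 (n : nat) : n <> 0%nat -> RtoC (INR n) <> 0.
Proof. intros Hn E; apply RtoC_inj in E; revert E; apply not_0_INR, Hn. Qed.

Lemma rgauss_S (z : C) (n : nat) :
  rgauss z (S (S n)) = rgauss z (S n) * (1 + rgauss_step n z).
Proof.
unfold rgauss, rgauss_step.
replace (fact (S (S n))) with (S (S n) * fact (S n))%nat by reflexivity.
replace (INR n + 2)%R with (INR (S (S n))) by (rewrite !S_INR; ring).
rewrite mult_INR, RtoC_mult, RtoC_inv by (apply not_0_INR; discriminate).
replace (Cexp (- (z * ln (INR (S (S n))))))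
  with (Cexp (- (z * ln (INR (S n)))) * Cexp (RtoC (- ln_step n) * z)).
2: { rewrite <- Cexp_plus; f_equal; unfold ln_step.
     rewrite RtoC_opp, RtoC_minus; ring. }
change (rising z (S (S n))) with (rising z (S n) * (z + INR (S (S n)))).
field; split; apply RtoC_INR_neq_0; [discriminate|apply fact_neq_0].
Qed.

(** Both bounds are ln x <= x - 1, taken at (n+2)/(n+1) and at its inverse. *)
Lemma ln_step_bounds (n : nat) : (/ (INR n + 2) <= ln_step n <= / (INR n + 1))%R.
Proof.
unfold ln_step; rewrite !S_INR.
pose proof (pos_INR n).
rewrite <- ln_div by lra; split.
- assert (E : ((INR n + 1 + 1) / (INR n + 1) = / ((INR n + 1) / (INR n + 1 + 1)))%R)
    by (field; lra).
  assert (P : (0 < (INR n + 1) / (INR n + 1 + 1))%R) by (apply Rdiv_lt_0_compat; lra).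
  rewrite E, ln_Rinv by trivial.
  pose proof (ln_le_minus_1 _ P).
  replace (/ (INR n + 2))%R with (1 - (INR n + 1) / (INR n + 1 + 1))%R by (field; lra).
  lra.
- assert (P : (0 < (INR n + 1 + 1) / (INR n + 1))%R) by (apply Rdiv_lt_0_compat; lra).
  pose proof (ln_le_minus_1 _ P).
  replace (/ (INR n + 1))%R with ((INR n + 1 + 1) / (INR n + 1) - 1)%R by (field; lra).
  lra.
Qed.

(** Put b = 1/(n+2), a = [ln_step n] and R = e^(-az) - 1 + az. The step equals (b - a) z - ab z^2 +
    (1 + bz) R. Since b <= a <= 1/(n+1), both a - b and ab are at most [inv_prod n], while R has
    norm at most a constant times a^2 <= 2 [inv_prod n]. *)
Lemma jet_bound_rgauss_step (w : C) :
  exists K, (0 <= K)%R /\ forall n, exists d,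
  jet_bound (fun h => rgauss_step n (w + h)) d (K * inv_prod n).
Proof.
destruct (jet_bound_exp_remainder w 1) as (K & HK & He).
pose proof (Cmod_ge_0 w) as Hw.
set (r := (1 + Cmod w)%R).
assert (Hr : (1 <= r)%R) by (unfold r; lra).
exists (r + 3 * (r * r) + 3 * ((1 + r) * K) * 2)%R; split.
{ assert (0 <= r * r)%R by (apply Rmult_le_pos; lra).
  assert (0 <= (1 + r) * K)%R by (apply Rmult_le_pos; lra). lra. }
intros n; pose proof (pos_INR n) as Hn.
destruct (ln_step_bounds n) as [L1 L2].
set (a := ln_step n) in *; set (b := (/ (INR n + 2))%R) in *.
assert (Hb : (0 < b)%R) by (apply Rinv_0_lt_compat; lra).
assert (Hi : (0 < / (INR n + 1))%R) by (apply Rinv_0_lt_compat; lra).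
assert (Hb1 : (/ (INR n + 1) <= 1)%R)
  by (rewrite <- Rinv_1; apply Rinv_le_contravar; lra).
assert (Eb : (inv_prod n = / (INR n + 1) * b)%R)
  by (unfold inv_prod, b; field; lra).
assert (Ed : (inv_prod n = / (INR n + 1) - b)%R)
  by (unfold inv_prod, b; field; lra).
assert (Hb2 : (/ (INR n + 1) <= 2 * b)%R).
{ unfold b; apply Rmult_le_reg_r with ((INR n + 1) * (INR n + 2))%R;
    [apply Rmult_lt_0_compat; lra|].
  replace (/ (INR n + 1) * ((INR n + 1) * (INR n + 2)))%R with (INR n + 2)%R
    by (field; lra).
  replace (2 * / (INR n + 2) * ((INR n + 1) * (INR n + 2)))%R with (2 * (INR n + 1))%R
    by (field; lra).
  lra. }
assert (Ea : Cmod (RtoC (- a)) = a) by (rewrite Cmod_R, Rabs_Ropp, Rabs_pos_eq; lra).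
destruct (He (RtoC (- a))) as [d Jd]; [rewrite Ea; lra|].
rewrite Ea in Jd.
pose proof (jet_bound_id w) as Jz; fold r in Jz.
pose proof (jet_bound_scal (RtoC (b - a)) _ _ _ Jz) as J1.
pose proof (jet_bound_scal (RtoC (- (a * b))) _ _ _ (jet_bound_mult _ _ _ _ _ _ Jz Jz)) as J2.
pose proof (jet_bound_plus _ _ _ _ _ _ (jet_bound_const 1)
  (jet_bound_scal (RtoC b) _ _ _ Jz)) as J3.
pose proof (jet_bound_mult _ _ _ _ _ _ J3 Jd) as J4.
eexists; eapply jet_bound_ext; [|eapply jet_bound_le;
  [exact (jet_bound_plus _ _ _ _ _ _ (jet_bound_plus _ _ _ _ _ _ J1 J2) J4)|]].
- intros h _; cbv beta; unfold rgauss_step; fold a b.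
  rewrite RtoC_minus, !RtoC_opp, RtoC_mult; ring.
- rewrite Cmod_1, !Cmod_R, Rabs_Ropp, (Rabs_left1 (b - a)), (Rabs_pos_eq (a * b)),
    (Rabs_pos_eq b) by (try apply Rmult_le_pos; lra).
  assert (X1 : (- (b - a) * r <= r * inv_prod n)%R)
    by (rewrite Rmult_comm; apply Rmult_le_compat_l; lra).
  assert (X2 : (a * b * (3 * (r * r)) <= 3 * (r * r) * inv_prod n)%R).
  { rewrite Rmult_comm; apply Rmult_le_compat_l.
    - assert (0 <= r * r)%R by (apply Rmult_le_pos; lra); lra.
    - rewrite Eb; apply Rmult_le_compat_r; lra. }
  assert (X3 : ((1 + b * r) * (K * (a * a)) <= (1 + r) * (K * (2 * inv_prod n)))%R).
  { apply Rmult_le_compat.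
    - assert (0 <= b * r)%R by (apply Rmult_le_pos; lra); lra.
    - repeat apply Rmult_le_pos; lra.
    - apply Rplus_le_compat_l; rewrite <- (Rmult_1_l r) at 2.
      apply Rmult_le_compat_r; lra.
    - apply Rmult_le_compat_l; trivial; rewrite Eb.
      apply Rle_trans with (/ (INR n + 1) * (2 * b))%R; [|lra].
      apply Rmult_le_compat; lra. }
  lra.
Qed.

Lemma rising_neq_0 (z : C) (n : nat) : ~ Gamma_pole z -> rising z n <> 0.
Proof.
intros Hz.
assert (E : forall m, z + INR m <> 0).
{ intros m E; apply Hz; exists m.
  replace z with (z + INR m - INR m) by ring; rewrite E; ring. }
induction n as [|n IH].
- cbn; specialize (E 0%nat); cbn in E; rewrite Cplus_0_r in E; exact E.
- apply Cmult_neq_0; auto.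
Qed.

Lemma rising_pole (m n : nat) : (m <= n)%nat -> rising (- INR m) n = 0.
Proof.
intros H; induction H as [|n _ IH].
- destruct m; cbn -[INR]; [cbn; ring|ring].
- cbn -[INR]; rewrite IH; ring.
Qed.

Lemma rgauss_neq_0 (z : C) (n : nat) : ~ Gamma_pole z -> rgauss z n <> 0.
Proof.
intros Hz; unfold rgauss; repeat apply Cmult_neq_0.
- apply rising_neq_0, Hz.
- apply Cexp_neq_0.
- rewrite <- RtoC_inv by apply INR_fact_neq_0.
  intros E; apply RtoC_inj in E; revert E; apply Rinv_neq_0_compat, INR_fact_neq_0.
Qed.

Lemma filterlim_eventually_S (u : nat -> C) (l : C) :
  filterlim (fun n => u (S n)) eventually (locally (T := C_UniformSpace) l) ->
  filterlim u eventually (locally (T := C_UniformSpace) l).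
Proof.
intros H P HP; destruct (H P HP) as [N HN]; exists (S N).
intros [|n] Hn; [lia|]; apply HN; lia.
Qed.

(** At a pole, [rgauss z n] vanishes from some rank on, so the limit is the prescribed value 0.
    Elsewhere [product_neq_0] gives a nonzero limit, hence Gauss' product converges to its inverse
    and [/ CGamma z] recovers it. *)
Lemma CrGamma_unique (z l : C) :
  filterlim (rgauss z) eventually (locally (T := C_UniformSpace) l) -> CrGamma z = l.
Proof.
intros Hl; unfold CrGamma; destruct excluded_middle_informative as [[m Hm] | Hz].
- apply (filterlim_locally_unique (K := C_AbsRing) (V := C_NormedModule)
    (F := eventually) (rgauss z)); trivial.
  apply (filterlim_ext_loc (fun _ => RtoC 0)); [|apply filterlim_const].
  exists m; intros n Hn; unfold rgauss; rewrite Hm, rising_pole by trivial; ring.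
- assert (Hl0 : l <> 0).
  { destruct (jet_bound_rgauss_step z) as (K & HK & HS).
    apply (product_neq_0 (fun n h => rgauss (z + h) (S n))
      (fun n h => rgauss_step n (z + h)) K HK).
    - intros n h _; apply rgauss_S.
    - exact HS.
    - intros n; rewrite Cplus_0_r; apply rgauss_neq_0, Hz.
    - rewrite Cplus_0_r; intros P HP; destruct (Hl P HP) as [N HN].
      exists N; intros n Hn; apply HN; lia. }
  replace (CGamma z) with (/ l); [field; trivial|].
  symmetry; apply C_lim_seq_correct.
  apply (filterlim_ext (fun n => / rgauss z n)); [|apply C_filterlim_inv; trivial].
  intros n; unfold rgauss.
  rewrite Cexp_opp.
  field; repeat split; auto using Cexp_neq_0, rising_neq_0.
  apply RtoC_INR_neq_0, fact_neq_0.
Qed.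

Lemma rgauss_converges (w : C) :
  exists L d M, jet_bound L d M /\ forall h, (Cmod h <= 1)%R ->
  filterlim (rgauss (w + h)) eventually (locally (T := C_UniformSpace) (L h)).
Proof.
destruct (jet_bound_rgauss_step w) as (K & HK & HS).
destruct (product_converges (fun n h => rgauss (w + h) (S n))
  (fun n h => rgauss_step n (w + h)) K HK) as (L & d & M & J & HL).
(* The product starts from rank 1, where the reciprocal is the polynomial z (z + 1), as ln 1 = 0. *)
- pose proof (jet_bound_id w) as Jz.
  eexists; eexists; eapply jet_bound_ext;
    [|exact (jet_bound_mult _ _ _ _ _ _ Jz
       (jet_bound_plus _ _ _ _ _ _ (jet_bound_const 1) Jz))].
  intros h _; unfold rgauss; cbn -[Cexp ln].
  rewrite ln_1, Cmult_0_r.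
  replace (- RtoC 0) with (RtoC 0) by ring; rewrite Cexp_0; field; apply C1_nz.
- intros n h _; apply rgauss_S.
- exact HS.
- exists L, d, M; split; [exact J|].
  intros h Hh; apply filterlim_eventually_S, HL, Hh.
Qed.

Lemma jet_bound_CrGamma (w : C) : exists d M, jet_bound (fun h => CrGamma (w + h)) d M.
Proof.
destruct (rgauss_converges w) as (L & d & M & J & HL).
exists d, M; apply jet_bound_ext with (2 := J).
intros h Hh; symmetry; apply CrGamma_unique, HL, Hh.
Qed.

Lemma rgauss_lim (z : C) :
  filterlim (rgauss z) eventually (locally (T := C_UniformSpace) (CrGamma z)).
Proof.
destruct (rgauss_converges z) as (L & _ & _ & _ & HL).
specialize (HL 0 Cmod_0_le_1); rewrite Cplus_0_r in HL.
rewrite (CrGamma_unique _ _ HL); exact HL.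
Qed.

Lemma rising_shift (z : C) (n : nat) :
  z * rising (z + 1) n = rising z n * (z + INR (S n)).
Proof.
induction n as [|n IH].
- cbn; ring.
- change (rising (z + 1) (S n)) with (rising (z + 1) n * (z + 1 + INR (S n))).
  rewrite Cmult_assoc, IH, (S_INR (S n)), RtoC_plus; cbn [rising]; ring.
Qed.

(** Shifting the rising product brings in z + n + 1 and the extra power of n brings in 1/n, so z *
    [rgauss (z + 1) n] is [rgauss z n] times 1 + (z + 1)/n. The last factor tends to 1. *)
Lemma CrGamma_S (z : C) : CrGamma z = z * CrGamma (z + 1).
Proof.
symmetry.
apply (filterlim_locally_unique (K := C_AbsRing) (V := C_NormedModule)
  (F := eventually) (fun n => z * rgauss (z + 1) n)).
{ apply C_filterlim_mult; [apply filterlim_const|apply rgauss_lim]. }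
apply (filterlim_ext_loc (fun n => rgauss z n * (1 + (z + 1) * RtoC (/ INR n)))).
- exists 1%nat; intros n Hn; unfold rgauss.
  assert (Hn0 : INR n <> 0%R) by (apply not_0_INR; lia).
  assert (E : Cexp (- ((z + 1) * ln (INR n))) = Cexp (- (z * ln (INR n))) * / INR n).
  { replace (- ((z + 1) * ln (INR n))) with (- (z * ln (INR n)) + RtoC (- ln (INR n)))
      by (rewrite RtoC_opp; ring).
    rewrite Cexp_plus, Cexp_R, exp_Ropp, exp_ln, RtoC_inv
      by (trivial; apply lt_0_INR; lia).
    reflexivity. }
  rewrite E, !Cmult_assoc, rising_shift, S_INR, RtoC_plus, RtoC_inv by trivial.
  field; split; apply RtoC_INR_neq_0; [apply fact_neq_0|lia].
- replace (CrGamma z) with (CrGamma z * (1 + (z + 1) * 0)) by ring.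
  apply C_filterlim_mult; [apply rgauss_lim|].
  apply C_filterlim_Cmod; intros eps Heps.
  pose proof (Cmod_ge_0 (z + 1)) as Hz.
  destruct (nfloor_ex (Cmod (z + 1) / eps)) as [N HN].
  { apply Rmult_le_pos; trivial; left; apply Rinv_0_lt_compat, Heps. }
  exists (S N); intros n Hn.
  assert (Hn0 : (0 < INR n)%R) by (apply lt_0_INR; lia).
  assert (Hle : (INR (S N) <= INR n)%R) by (apply le_INR, Hn).
  rewrite S_INR in Hle.
  replace (1 + (z + 1) * RtoC (/ INR n) - (1 + (z + 1) * 0))
    with ((z + 1) * RtoC (/ INR n)) by ring.
  rewrite Cmod_mult, Cmod_R, Rabs_pos_eq by (left; apply Rinv_0_lt_compat, Hn0).
  apply Rmult_lt_reg_r with (INR n); trivial.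
  rewrite Rmult_assoc, Rinv_l, Rmult_1_r by lra.
  replace (Cmod (z + 1)) with (Cmod (z + 1)%C / eps * eps)%R by (field; lra).
  rewrite (Rmult_comm eps); apply Rmult_lt_compat_r; lra.
Qed.

(** From some rank on, [CrGamma (w + h + INR s)] is obtained from its predecessor
    by a division by a number of modulus at least 1, whose 1-jet norm is at most 1. *)
Lemma jet_bound_CrGamma_shift (w : C) :
  exists A : R, forall s : nat, exists d,
  jet_bound (fun h => CrGamma (w + INR s + h)) d (A * 3 ^ s).
Proof.
(* Here N + 1 > |w| + 2, so for s >= N + 1 and |h| <= 1 one has |w + s + h| >= s - |w| - 1 >= 1. The
   finitely many earlier ranks are absorbed into [A] by a maximum. *)
destruct (nfloor_ex (Cmod w + 2)) as [N HN];
  [pose proof (Cmod_ge_0 w); lra|].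
assert (P : forall n, (1 <= 3 ^ n)%R) by (intros n; apply pow_R1_Rle; lra).
assert (H0 : exists A, forall s, (s <= S N)%nat -> exists d,
  jet_bound (fun h => CrGamma (w + INR s + h)) d (A * 3 ^ s)).
{ induction (S N) as [|m [A IH]].
  - destruct (jet_bound_CrGamma (w + INR 0)) as (d & M & J).
    exists M; intros s Hs; exists d; replace s with 0%nat by lia.
    rewrite Rmult_1_r; exact J.
  - destruct (jet_bound_CrGamma (w + INR (S m))) as (d & M & J).
    exists (Rmax A M); intros s Hs.
    pose proof (Rmax_l A M); pose proof (Rmax_r A M); specialize (P s).
    destruct (Nat.eq_dec s (S m)) as [-> | Hsm].
    + exists d; apply jet_bound_le with (1 := J).
      pose proof (jet_bound_pos _ _ _ J).
      rewrite <- (Rmult_1_r M) at 1; apply Rmult_le_compat; lra.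
    + destruct (IH s ltac:(lia)) as [e Je].
      exists e; apply jet_bound_le with (1 := Je); apply Rmult_le_compat_r; lra. }
destruct H0 as [A HA]; exists A.
induction s as [|s [d J]]; [apply HA; lia|].
destruct (Nat.le_gt_cases (S s) (S N)) as [Hs | Hs]; [apply HA, Hs|].
assert (HI : forall h, (Cmod h <= 1 -> 1 <= Cmod (w + INR s + h))%R).
{ intros h Hh.
  pose proof (Cmod_triangle (w + INR s + h) (- (w + h))) as T.
  replace (w + INR s + h + - (w + h)) with (RtoC (INR s)) in T by ring.
  rewrite Cmod_opp, Cmod_R, Rabs_pos_eq in T by apply pos_INR.
  pose proof (Cmod_triangle w h).
  assert (INR (S N) <= INR s)%R by (apply le_INR; lia).
  rewrite S_INR in H0; lra. }
(* The inverse has norm at most 1, so the base 3 of the geometric bound is just the constant of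
   [jet_bound_mult]. *)
eexists; eapply jet_bound_ext; [|eapply jet_bound_le;
  [exact (jet_bound_mult _ _ _ _ _ _ J (jet_bound_inv _ HI))|]].
- intros h Hh; cbv beta.
  rewrite (CrGamma_S (w + INR s + h)), S_INR, RtoC_plus.
  replace (w + INR s + h + 1) with (w + (INR s + 1) + h) by ring.
  field; intros E; specialize (HI h Hh); rewrite E, Cmod_0 in HI; lra.
- cbn; right; ring.
Qed.

(** * The Bessel series *)

(** The term of the classical series for J_nu(z), with [l] in the role of the chosen logarithm of
    z/2. *)
Definition Bessel_term (l nu : C) (s : nat) : C :=
  RtoC ((-1) ^ s / INR (fact s)) * CrGamma (nu + INR s + 1) * Cexp ((nu + 2 * INR s) * l).

Definition Bessel (l nu : C) : C := C_Series (Bessel_term l nu).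

(** Writing e^((nu+h+2s) l) as (e^(2l))^s e^(l (nu+h)) leaves one exponential that does not depend
    on s. With the bound A 3^s for the Gamma factor, the norms are dominated by the exponential
    series at 3 |e^(2l)|. *)
Lemma jet_bound_Bessel_term (l nu : C) :
  exists d M, (forall s, jet_bound (fun h => Bessel_term l (nu + h) s) (d s) (M s)) /\
  ex_series M.
Proof.
destruct (jet_bound_CrGamma_shift (nu + 1)) as [A HA].
destruct (jet_bound_Cexp l nu) as (e & B & HB).
set (Q := Cmod (Cexp (l * 2))).
set (M := fun s : nat => (/ INR (fact s) * (3 * Q) ^ s * (3 * (A * B)))%R).
destruct (choice (fun s d => jet_bound (fun h => Bessel_term l (nu + h) s) d (M s)))
  as [d Hd].
- intros s; destruct (HA s) as [d J].
  eexists; eapply jet_bound_ext; [|eapply jet_bound_le;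
    [exact (jet_bound_scal (RtoC ((-1) ^ s / INR (fact s)) * Cexp (l * 2) ^ s) _ _ _
       (jet_bound_mult _ _ _ _ _ _ J HB))|]].
  + intros h _; cbv beta; unfold Bessel_term.
    replace ((nu + h + 2 * INR s) * l) with (INR s * (l * 2) + l * (nu + h)) by ring.
    rewrite Cexp_plus, Cexp_nat_mult.
    replace (nu + 1 + INR s + h) with (nu + h + INR s + 1) by ring.
    ring.
  + rewrite Cmod_mult, Cmod_R, Cmod_pow; fold Q; unfold M, Rdiv.
    rewrite Rabs_mult, pow_1_abs, Rabs_pos_eq, Rpow_mult_distr
      by (left; apply Rinv_0_lt_compat, INR_fact_lt_0).
    right; ring.
- exists d, M; split; [exact Hd|].
  apply ex_series_scal_R; exists (exp (3 * Q)); apply is_pseries_R, is_exp_Reals.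
Qed.

Lemma is_series_Bessel (l nu : C) : is_series (Bessel_term l nu) (Bessel l nu).
Proof.
destruct (jet_bound_Bessel_term l nu) as (d & M & HJ & HM).
pose proof (jet_bound_is_series _ _ _ 0 HJ HM Cmod_0_le_1) as H.
cbv beta in H; rewrite Cplus_0_r in H; exact H.
Qed.

Lemma jet_bound_Bessel (l nu : C) : exists d M, jet_bound (fun h => Bessel l (nu + h)) d M.
Proof.
destruct (jet_bound_Bessel_term l nu) as (d & M & HJ & HM).
eexists; eexists; exact (jet_bound_series _ _ _ HJ HM).
Qed.

(** * Idempotent components *)

(** Scalar factors in front and [z1 + - z2] for the difference match the rules for sums, opposites
    and scalar multiples of series and limits. *)
Lemma of_idem_val (z1 z2 : C) :
  of_idem z1 z2 = (/ 2 * (z1 + z2), Ci / 2 * (z1 + - z2)).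
Proof.
unfold of_idem; rewrite e1_val, e2_val; BC_unfold; f_equal; field; exact RtoC2_neq_0.
Qed.

Lemma idem1_mult (Z W : BC) : idem1 (Z * W)%BC = idem1 Z * idem1 W.
Proof.
destruct Z as [a b], W as [c d]; BC_unfold.
transitivity (a * c + Ci * Ci * (b * d) - Ci * (a * d + b * c)); [|ring].
rewrite Ci_sqr; ring.
Qed.

Lemma idem2_mult (Z W : BC) : idem2 (Z * W)%BC = idem2 Z * idem2 W.
Proof.
destruct Z as [a b], W as [c d]; BC_unfold.
transitivity (a * c + Ci * Ci * (b * d) + Ci * (a * d + b * c)); [|ring].
rewrite Ci_sqr; ring.
Qed.

Lemma idem1_plus (Z W : BC) : idem1 (Z + W)%BC = idem1 Z + idem1 W.
Proof. BC_unfold; ring. Qed.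

Lemma idem2_plus (Z W : BC) : idem2 (Z + W)%BC = idem2 Z + idem2 W.
Proof. BC_unfold; ring. Qed.

Lemma idem1_minus (Z W : BC) : idem1 (Z - W)%BC = idem1 Z - idem1 W.
Proof. BC_unfold; ring. Qed.

Lemma idem2_minus (Z W : BC) : idem2 (Z - W)%BC = idem2 Z - idem2 W.
Proof. BC_unfold; ring. Qed.

Lemma idem1_RtoBC (r : R) : idem1 (RtoBC r) = r.
Proof. BC_unfold; ring. Qed.

Lemma idem2_RtoBC (r : R) : idem2 (RtoBC r) = r.
Proof. BC_unfold; ring. Qed.

Lemma not_O2_idem (Z : BC) : ~ O2 Z -> idem1 Z <> 0 /\ idem2 Z <> 0.
Proof.
rewrite O2_idem; intros H; split; intros E; apply H; rewrite E; ring.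
Qed.

Lemma idem1_div (Z W : BC) : ~ O2 W -> idem1 (Z / W)%BC = idem1 Z / idem1 W.
Proof.
intros H; destruct (not_O2_idem W H) as [H1 _].
unfold BCdiv; rewrite idem1_mult.
pose proof (f_equal idem1 (BCinv_r W H)) as E; rewrite idem1_mult, idem1_RtoBC in E.
transitivity (idem1 Z * (idem1 W * idem1 (/ W)%BC) / idem1 W); [field; exact H1|].
rewrite E; field; exact H1.
Qed.

Lemma idem2_div (Z W : BC) : ~ O2 W -> idem2 (Z / W)%BC = idem2 Z / idem2 W.
Proof.
intros H; destruct (not_O2_idem W H) as [_ H2].
unfold BCdiv; rewrite idem2_mult.
pose proof (f_equal idem2 (BCinv_r W H)) as E; rewrite idem2_mult, idem2_RtoBC in E.
transitivity (idem2 Z * (idem2 W * idem2 (/ W)%BC) / idem2 W); [field; exact H2|].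
rewrite E; field; exact H2.
Qed.

Lemma BC_Series_of_idem (a b : nat -> C) (x y : C) :
  is_series a x -> is_series b y ->
  BC_Series (fun n => of_idem (a n) (b n)) = of_idem x y.
Proof.
intros Ha Hb; rewrite of_idem_val; unfold BC_Series; f_equal.
- apply C_Series_unique.
  eapply is_series_ext; [intros n; rewrite of_idem_val; reflexivity|].
  apply (is_series_scal (V := C_NormedModule)), (is_series_plus (V := C_NormedModule)); trivial.
- apply C_Series_unique.
  eapply is_series_ext; [intros n; rewrite of_idem_val; reflexivity|].
  apply (is_series_scal (V := C_NormedModule)), (is_series_minus (V := C_NormedModule)); trivial.
Qed.

(** Taking idempotent components respects sums and products, so each term splits; the two component
    series converge, so their sums recombine linearly. *)
Lemma BCBesselJ_idem (log1 log2 : C -> C) (V Z : BC) :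
  BCBesselJ log1 log2 V Z =
  of_idem (Bessel (log1 (idem1 (Z / RtoBC 2)%BC)) (idem1 V))
    (Bessel (log2 (idem2 (Z / RtoBC 2)%BC)) (idem2 V)).
Proof.
unfold BCBesselJ.
rewrite <- (BC_Series_of_idem _ _ _ _ (is_series_Bessel _ _) (is_series_Bessel _ _)).
f_equal; apply functional_extensionality; intros s.
rewrite <- (of_idem_idem (BCBesselJ_term log1 log2 V Z s)).
unfold BCBesselJ_term, BCrGamma, BCpower, Cpower, Bessel_term.
f_equal.
- rewrite !idem1_mult, !idem1_of_idem, !idem1_plus, !idem1_RtoBC, RtoC_mult; reflexivity.
- rewrite !idem2_mult, !idem2_of_idem, !idem2_plus, !idem2_RtoBC, RtoC_mult; reflexivity.
Qed.

(** * Limits and differentiability in idempotent components *)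

Lemma filterlim_of_idem {T} (F : (T -> Prop) -> Prop) {FF : Filter F}
  (u v : T -> C) (x y : C) :
  filterlim u F (locally (T := C_UniformSpace) x) ->
  filterlim v F (locally (T := C_UniformSpace) y) ->
  filterlim (fun t => of_idem (u t) (v t)) F
    (locally (T := prod_UniformSpace C_UniformSpace C_UniformSpace) (of_idem x y)).
Proof.
intros Hu Hv.
assert (Hp : forall c (w : T -> C) z, filterlim w F (locally (T := C_UniformSpace) z) ->
  filterlim (fun t => c * (u t + w t)) F (locally (T := C_UniformSpace) (c * (x + z)))).
{ intros c w z Hw; apply C_filterlim_mult; [apply filterlim_const|].
  apply (filterlim_comp_2 _ _ _ Hu Hw (filterlim_plus (V := C_NormedModule) x z)). }
assert (H1 := Hp (/ 2) _ _ Hv).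
assert (H2 := Hp (Ci / 2) _ _
  (filterlim_comp _ _ _ _ _ _ _ _ Hv (filterlim_opp (V := C_NormedModule) y))).
apply filterlim_locally; intros eps.
generalize (filter_and _ _ (proj1 (filterlim_locally _ _) H1 eps)
  (proj1 (filterlim_locally _ _) H2 eps)).
apply filter_imp; intros t Ht; rewrite !of_idem_val; exact Ht.
Qed.

Lemma idem_continuous (W0 : BC) (eps : R) : (0 < eps)%R ->
  locally (T := prod_UniformSpace C_UniformSpace C_UniformSpace) W0
    (fun W => Cmod (idem1 (W - W0)%BC) < eps /\ Cmod (idem2 (W - W0)%BC) < eps)%R.
Proof.
intros Heps; destruct W0 as [a0 b0].
assert (H1 := proj1 (C_filterlim_Cmod _ _) 
  (continuous_fst (U := C_UniformSpace) (V := C_UniformSpace) a0 b0)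
  (eps / 2)%R ltac:(lra)).
assert (H2 := proj1 (C_filterlim_Cmod _ _) 
  (continuous_snd (U := C_UniformSpace) (V := C_UniformSpace) a0 b0)
  (eps / 2)%R ltac:(lra)).
generalize (filter_and _ _ H1 H2); apply filter_imp; intros W [D1 D2].
assert (E : Cmod (Ci * (snd W - b0)) = Cmod (snd W - b0))
  by (rewrite Cmod_mult, Cmod_Ci; ring).
change (Cmod (snd W - b0) < eps / 2)%R in D2; change (Cmod (fst W - a0) < eps / 2)%R in D1.
rewrite <- E in D2; clear E.
change (idem1 (W - (a0, b0))%BC) with ((fst W - a0) - Ci * (snd W - b0)).
change (idem2 (W - (a0, b0))%BC) with ((fst W - a0) + Ci * (snd W - b0)).
split.
- eapply Rle_lt_trans; [apply Cmod_minus_le|lra].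
- eapply Rle_lt_trans; [apply Cmod_triangle|lra].
Qed.

(** The quotient differs from [d] by at most M |p t|. The increment is a map [p] along a filter
    because it will be one component of a bicomplex W - W0. *)
Lemma filterlim_jet_quotient {T} (F : (T -> Prop) -> Prop) {FF : Filter F}
  (f : C -> C) (z d : C) (M : R) (p : T -> C) :
  jet_bound (fun h => f (z + h)) d M ->
  (forall eps, 0 < eps -> F (fun t => p t <> 0 /\ Cmod (p t) < eps)) ->
  filterlim (fun t => (f (z + p t) - f z) / p t) F (locally (T := C_UniformSpace) d).
Proof.
intros J Hp; pose proof (jet_bound_pos _ _ _ J) as HM; destruct J as [_ J].
apply C_filterlim_Cmod; intros eps Heps.
(* M + 1 replaces M, which may be 0. *)
assert (He : (0 < eps / (M + 1))%R) by (apply Rdiv_lt_0_compat; lra).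
generalize (Hp (Rmin 1 (eps / (M + 1))) (Rmin_glb_lt _ _ _ Rlt_0_1 He)).
apply filter_imp; intros t [H0 Ht]; set (h := p t) in *.
apply Cmod_gt_0 in H0 as Hh.
pose proof (Rmin_l 1 (eps / (M + 1))); pose proof (Rmin_r 1 (eps / (M + 1))).
destruct (J h ltac:(lra)) as (_ & _ & Q); rewrite Cplus_0_r in Q.
replace ((f (z + h) - f z) / h - d) with ((f (z + h) - f z - d * h) / h)
  by (field; trivial).
rewrite Cmod_div by trivial.
apply Rle_lt_trans with (M * Cmod h)%R.
- apply Rmult_le_reg_r with (Cmod h); trivial.
  unfold Rdiv; rewrite Rmult_assoc, Rinv_l, Rmult_1_r by lra; lra.
- assert (Hlt : (Cmod h * (M + 1) < eps / (M + 1) * (M + 1))%R)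
    by (apply Rmult_lt_compat_r; lra).
  replace (eps / (M + 1) * (M + 1))%R with eps in Hlt by (field; lra).
  lra.
Qed.

(** When W - W0 is not a zero divisor, both its components are nonzero and division acts on each
    separately. The bicomplex quotient is then made of two complex difference quotients, with limits
    [d1] and [d2]. *)
Lemma BC_differentiable_of_idem (f1 f2 : C -> C) (W0 : BC) (d1 d2 : C) (M1 M2 : R) :
  jet_bound (fun h => f1 (idem1 W0 + h)) d1 M1 ->
  jet_bound (fun h => f2 (idem2 W0 + h)) d2 M2 ->
  BC_differentiable_at (fun _ => True)
    (fun W => of_idem (f1 (idem1 W)) (f2 (idem2 W))) W0.
Proof.
intros J1 J2; exists (of_idem d1 d2).
set (F := within _ _).
assert (FF : Filter F) by apply within_filter, locally_filter.
assert (HF : forall eps, (0 < eps)%R -> F (fun W => ~ O2 (W - W0)%BC /\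
  Cmod (idem1 (W - W0)%BC) < eps /\ Cmod (idem2 (W - W0)%BC) < eps)%R).
{ intros eps Heps; unfold F, within.
  eapply filter_imp; [|exact (idem_continuous W0 eps Heps)].
  intros W H [_ HO]; split; trivial. }
apply (filterlim_ext_loc (fun W => of_idem
  ((f1 (idem1 W0 + idem1 (W - W0)%BC) - f1 (idem1 W0)) / idem1 (W - W0)%BC)
  ((f2 (idem2 W0 + idem2 (W - W0)%BC) - f2 (idem2 W0)) / idem2 (W - W0)%BC))).
- generalize (HF 1%R Rlt_0_1); apply filter_imp; intros W [HO _].
  rewrite <- (of_idem_idem (_ / _)%BC), idem1_div, idem2_div by trivial.
  rewrite (idem1_minus (of_idem _ _)), (idem2_minus (of_idem _ _)),
    !idem1_of_idem, !idem2_of_idem.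
  f_equal; f_equal; f_equal; f_equal; rewrite ?idem1_minus, ?idem2_minus; ring.
- apply (filterlim_of_idem F).
  + apply (filterlim_jet_quotient F _ _ _ _ _ J1); intros eps Heps.
    generalize (HF eps Heps); apply filter_imp; intros W (HO & H & _).
    split; trivial; apply not_O2_idem, HO.
  + apply (filterlim_jet_quotient F _ _ _ _ _ J2); intros eps Heps.
    generalize (HF eps Heps); apply filter_imp; intros W (HO & _ & H).
    split; trivial; apply not_O2_idem, HO.
Qed.

Theorem theorem5p2 :
  forall (log1 log2 : C -> C), is_log log1 -> is_log log2 ->
  forall Z : BC, ~ O2 Z ->
  BC_holomorphic (fun _ : BC => True) (fun V : BC => BCBesselJ log1 log2 V Z).
Proof.
intros log1 log2 _ _ Z _ W0 _.
(* For fixed Z the logarithms at the components of Z/2 are constants, so V enters only through the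
   orders of the two classical functions. *)
rewrite (functional_extensionality _ _ (fun V => BCBesselJ_idem log1 log2 V Z)).
destruct (jet_bound_Bessel (log1 (idem1 (Z / RtoBC 2)%BC)) (idem1 W0)) as (d1 & M1 & J1).
destruct (jet_bound_Bessel (log2 (idem2 (Z / RtoBC 2)%BC)) (idem2 W0)) as (d2 & M2 & J2).
exact (BC_differentiable_of_idem _ _ _ _ _ _ _ J1 J2).
Qed.
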